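(* Consider $\mathbb{Z}^2$ with standard generating set $\{a,b\}$, $a=(1,0)$, $b=(0,1)$. Let $D\subseteq\{a,b,a^{-1},b^{-1}\}$ with $|D|\in\{2,3\}$. Then the infinite snake problem for $(\mathbb{Z}^2,\{a,b\})$ restricted to directions in $D$ is decidable.
   Context: A tileset graph for $(\mathbb{Z}^2,\{a,b\})$ is a finite multigraph $\Gamma=(A,B)$ whose edges are triples $(t,t',s)$ with $t,t'\in A$, $s\in\{a,b,a^{-1},b^{-1}\}$, such that $(t,t',s)\in B$ implies $(t',t,s^{-1})\in B$. A bi-infinite $\Gamma$-snake is a pair $(\omega,\zeta)$, $\omega:\mathbb{Z}\to\mathbb{Z}^2$ injective, $\zeta:\mathbb{Z}\to A$, with $d\omega_i:=\omega(i+1)-\omega(i)\in\{a,b,a^{-1},b^{-1}\}$ and $(\zeta(i),\zeta(i+1),d\omega_i)\in B$ for all $i$. The problem restricted to directions in $D$: given $\Gamma$, decide whether there is a bi-infinite $\Gamma$-snake with $d\omega_i\in D$ for all $i\in\mathbb{Z}$. *)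

(* Defs.v *)
From mathcomp Require Import all_boot all_order all_algebra.
Set Implicit Arguments. Unset Strict Implicit. Unset Printing Implicit Defensive.
Import GRing.Theory Num.Theory.
Local Open Scope ring_scope.

(** * Z^2 with generators a = (1,0), b = (0,1).
    Directions are encoded by 'I_4 : 0 = a, 1 = b, 2 = a^-1, 3 = b^-1. *)
Definition dvec (s : 'I_4) : int * int :=
  match val s with
  | 0%N => (1, 0)
  | 1%N => (0, 1)
  | 2%N => (-1, 0)
  | _ => (0, -1)
  end.

Definition dinv (s : nat) : nat := ((s + 2) %% 4)%N.

Definition vadd (u v : int * int) : int * int := (u.1 + v.1, u.2 + v.2).

(** * Tileset graphs.
    A tileset graph is given by a number [ntiles] of tiles (the tile set A is
    {0, ..., ntiles-1}) and a finite list of (possibly repeated) edges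
    (t, t', s), s being the code of a direction in {0,1,2,3}. *)
Record tgraph := TGraph { ntiles : nat; tedges : seq (nat * nat * nat) }.

Definition wf_tgraph (G : tgraph) : Prop :=
  (forall t t' s, (t, t', s) \in tedges G ->
     [/\ (t < ntiles G)%N, (t' < ntiles G)%N & (s < 4)%N]) /\
  (forall t t' s, (t, t', s) \in tedges G -> (t', t, dinv s) \in tedges G).

Definition dsnake (D : {set 'I_4}) (G : tgraph)
    (omega : int -> int * int) (zeta : int -> nat) : Prop :=
  injective omega /\
  forall i : int, exists s : 'I_4,
    [/\ s \in D, omega (i + 1) = vadd (omega i) (dvec s)
      & (zeta i, zeta (i + 1), val s) \in tedges G].

Definition has_dsnake (D : {set 'I_4}) (G : tgraph) : Prop :=
  exists omega zeta, dsnake D G omega zeta.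

(** * Computability model: Minsky register machines.
    Inc r j : increment register r, go to instruction j.
    Dec r j k : if register r is 0 go to k, else decrement it and go to j.
    The machine halts when the program counter leaves the program. *)
Inductive instr := Inc of nat & nat | Dec of nat & nat & nat.

Definition upd (f : nat -> nat) (r v : nat) : nat -> nat :=
  fun x => if x == r then v else f x.

Definition mstep (p : seq instr) (c : nat * (nat -> nat)) : nat * (nat -> nat) :=
  let: (pc, regs) := c in
  match nth (Inc 0 0) p pc with
  | Inc r j => (j, upd regs r (regs r).+1)
  | Dec r j k => if regs r == 0%N then (k, regs) else (j, upd regs r (regs r).-1)
  end.

Fixpoint mexec (p : seq instr) (fuel : nat) (c : nat * (nat -> nat))
    : option (nat -> nat) :=
  if (size p <= c.1)%N then Some c.2 else
  match fuel with
  | 0%N => None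
  | f.+1 => mexec p f (mstep p c)
  end.

Definition minit (x : nat) : nat * (nat -> nat) :=
  (0%N, fun r => if r == 0%N then x else 0%N).

Definition code_tgraph (G : tgraph) : nat := pickle (ntiles G, tedges G).

Definition decidable_tg (P : tgraph -> Prop) : Prop :=
  exists p : seq instr, forall G : tgraph, wf_tgraph G ->
    exists fuel regs, mexec p fuel (minit (code_tgraph G)) = Some regs /\
      ((regs 1%N = 1%N /\ P G) \/ (regs 1%N = 0%N /\ ~ P G)).

(* Main.v *)
Require Import Defs.
From mathcomp Require Import all_boot all_order all_algebra zify.

(** For [|D| <= 3] some direction [d] is missing. The displacement against [d]
    never decreases along a path with steps in [D], and while it is constant
    the path moves on a line; hence such a path is injective as soon as it
    never undoes its last step. So a snake is a bi-infinite walk in a finite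
    graph on the edges of the tileset: [c] is followed by [c'] if the tiles
    match and the directions are not opposite. Repeatedly deleting the
    edges that lack a successor or a predecessor leaves a nonempty set exactly
    when such a walk exists.

    The pruning is carried out on the Goedel codes of lists by a register
    machine. The machine is obtained from closure properties of the functions
    [seq nat -> nat] computed by structured programs: arguments sit in given
    registers, the result is pushed on the first free one, and all higher
    registers serve as scratch space. *)

Set Implicit Arguments.
Unset Strict Implicit.
Unset Printing Implicit Defensive.

(** * Structured programs for register machines *)

(* [PLoop r B] is "while r > 0 do r := r - 1; B". *)
Inductive prog :=
| PInc of nat
| PClear of nat
| PSeq of prog & prog
| PLoop of nat & prog.

(** Addresses are absolute: the code is laid out from [start] and always leaves to [exit]. Its
    length depends on neither, so [compile P 0 0] measures it. *)
Fixpoint compile (P : prog) (start exit : nat) : seq instr :=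
  match P with
  | PInc r => [:: Inc r exit]
  | PClear r => [:: Dec r start exit]
  | PSeq P1 P2 =>
      let c := compile P1 start (start + size (compile P1 0 0)) in
      c ++ compile P2 (start + size c) exit
  | PLoop r B => Dec r start.+1 exit :: compile B start.+1 start
  end.

Lemma size_compile P start exit start' exit' :
  size (compile P start exit) = size (compile P start' exit').
Proof.
elim: P start exit start' exit' => //= [P IHP Q IHQ|r B IHB] s x s' x'.
  by rewrite !size_cat (IHP _ _ s' (s' + size (compile P 0 0)));
     rewrite (IHQ _ _ (s' + size (compile P s' (s' + size (compile P 0 0)))) x').
by rewrite (IHB _ _ s'.+1 s').
Qed.

(** Quantifying over the remaining fuel lets runs compose by adding step counts. *)
Definition reach (p : seq instr) (c c' : nat * (nat -> nat)) : Prop :=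
  exists k, forall fuel, mexec p (k + fuel) c = mexec p fuel c'.

Lemma reach_trans p c1 c2 c3 : reach p c1 c2 -> reach p c2 c3 -> reach p c1 c3.
Proof. by move=> [k H] [l K]; exists (k + l) => f; rewrite -addnA H K. Qed.

Lemma reach_step p c : c.1 < size p -> reach p c (mstep p c).
Proof. by move=> lt_c; exists 1 => f /=; rewrite leqNgt lt_c. Qed.

Lemma nth_mid (p1 p2 : seq instr) i :
  nth (Inc 0 0) (p1 ++ i :: p2) (size p1) = i.
Proof. by rewrite nth_cat ltnn subnn. Qed.

(* Register files are compared pointwise, which avoids function
   extensionality. *)
Definition runs (P : prog) (f g : nat -> nat) : Prop :=
  forall pre post exit f', f' =1 f ->
  exists2 g', g' =1 g &
    reach (pre ++ compile P (size pre) exit ++ post)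
      (size pre, f') (exit, g').

Lemma eq_runs P f f' g g' : f =1 f' -> g =1 g' -> runs P f g -> runs P f' g'.
Proof.
move=> ff' gg' H pre post x h hf; case: (H pre post x h).
  by move=> i; rewrite hf ff'.
by move=> k kg; exists k => // i; rewrite kg gg'.
Qed.

Lemma eq_upd f g r v : f =1 g -> upd f r v =1 upd g r v.
Proof. by move=> fg i; rewrite /upd fg. Qed.

Lemma runs_inc r f : runs (PInc r) f (upd f r (f r).+1).
Proof.
move=> pre post x f' ff'; exists (upd f' r (f' r).+1).
  by rewrite ff'; apply: eq_upd.
have := @reach_step (pre ++ Inc r x :: post) (size pre, f').
by rewrite /= nth_mid size_cat /=; apply; lia.
Qed.

Lemma runs_clear r f : runs (PClear r) f (upd f r 0).
Proof.
move=> pre post x f' ff' /=; set p := pre ++ _.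
have step g := @reach_step p (size pre, g).
have lt_p : size pre < size p by rewrite /p size_cat /=; lia.
have {}step g : reach p (size pre, g) (mstep p (size pre, g)) by apply: step.
have [m fm] : exists m, f' r = m by exists (f' r).
elim: m f' f fm ff' => [|m IHm] f' f fm ff'.
  exists f'; first by move=> i; rewrite /upd; case: eqP => [->|//].
  by have := step f'; rewrite /= nth_mid fm.
case: (IHm (upd f' r m) (upd f r m)); rewrite ?/upd ?eqxx //.
  by move=> i; rewrite ff'.
move=> g Eg R; exists g; first by move=> i; rewrite Eg; case: eqP.
apply: reach_trans R.
by have := step f'; rewrite /= nth_mid fm.
Qed.

Arguments runs_inc : clear implicits.
Arguments runs_clear : clear implicits.

Lemma runs_seq P Q f g h : runs P f g -> runs Q g h -> runs (PSeq P Q) f h.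
Proof.
move=> HP HQ pre post x f' ff' /=.
set c1 := compile P _ _; set c2 := compile Q _ _.
have [g' gg' R1] := HP pre (c2 ++ post) (size pre + size (compile P 0 0)) f' ff'.
have [h' hh' R2] := HQ (pre ++ c1) post x g' gg'.
exists h' => //; move: R1 R2.
rewrite size_cat -!catA -/c1 -/c2 => R1; apply: reach_trans.
by rewrite {2}/c1 (size_compile _ _ _ 0 0).
Qed.

Lemma runs_loop0 r B f : f r = 0 -> runs (PLoop r B) f f.
Proof.
move=> f0 pre post x f' ff' /=; exists f' => //; set p := pre ++ _.
have := @reach_step p (size pre, f').
by rewrite /= nth_mid ff' f0 /=; apply; rewrite /p size_cat /=; lia.
Qed.

Lemma runs_loopS r B f g h m :
  f r = m.+1 -> runs B (upd f r m) g -> runs (PLoop r B) g h ->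
  runs (PLoop r B) f h.
Proof.
move=> fS HB HL pre post x f' ff' /=; set i := Dec _ _ _.
have [g' gg' R1] := HB (rcons pre i) post (size pre) _ (eq_upd r m ff').
have [h' hh' R2] := HL pre post x g' gg'.
exists h' => //; move: R1 R2; rewrite /= -/i size_rcons cat_rcons.
set p := pre ++ _ => R1 R2.
have : reach p (size pre, f') ((size pre).+1, upd f' r m).
  have := @reach_step p (size pre, f').
  by rewrite /= nth_mid /i /= ff' fS /=; apply; rewrite /p size_cat /=; lia.
by move/reach_trans; apply; apply: reach_trans R2.
Qed.

Ltac regs :=
  rewrite /upd /=;
  repeat match goal with |- context [?x == ?y] =>
    case: (x =P y) => /= [?|?]; [try subst x|] end;
  try congruence; try lia.

Definition move_reg a b := PLoop a (PInc b).

Lemma runs_move (a b : nat) f : a != b ->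
  runs (move_reg a b) f (upd (upd f b (f b + f a)) a 0).
Proof.
move=> ab; have [m fm] : exists m, f a = m by exists (f a).
elim: m f fm => [|m IHm] f fm.
  by apply: eq_runs (runs_loop0 _ fm) => // i; regs.
apply: (runs_loopS fm (runs_inc _ _)).
apply: eq_runs (IHm _ _) => //; last first.
  by rewrite /upd (negPf ab) eqxx.
by move/eqP: ab => ab i; regs.
Qed.

Arguments runs_move : clear implicits.

(** * Computable functions *)

(** Apart from the result in [n], all registers end as they began, the scratch ones at zero; this is
    what allows programs to be nested. *)
Definition computable (F : seq nat -> nat) : Prop :=
  forall vs n, all (fun v => v < n) vs -> exists P, forall f,
    (forall i, n <= i -> f i = 0) -> runs P f (upd f n (F (map f vs))).

Lemma eq_computable F G : F =1 G -> computable F -> computable G.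
Proof.
move=> FG HF vs n lt_vs; have [P HP] := HF vs n lt_vs.
by exists P => f f0; rewrite -FG; apply: HP.
Qed.

Lemma map_upd f vs n r x :
  all (fun v => v < n) vs -> n <= r -> map (upd f r x) vs = map f vs.
Proof.
move=> /allP lt_vs le_nr; apply/eq_in_map => v /lt_vs lt_v.
by rewrite /upd; case: eqP => // E; move: lt_v; rewrite E ltnNge le_nr.
Qed.

Lemma all_ltnW n m vs :
  n <= m -> all (fun v => v < n) vs -> all (fun v => v < m) vs.
Proof. by move=> le_nm; apply: sub_all => v /leq_trans; apply. Qed.

Lemma computable0 : computable (fun=> 0).
Proof. by move=> vs n _; exists (PClear n) => f _; apply: runs_clear. Qed.

Lemma computableS F : computable F -> computable (fun e => (F e).+1).
Proof.
move=> HF vs n lt_vs; have [P HP] := HF vs n lt_vs.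
exists (PSeq P (PInc n)) => f f0; apply: runs_seq (HP f f0) _.
by apply: eq_runs (runs_inc _ _) => // i; regs.
Qed.

Lemma computable_var i : computable (fun e => nth 0 e i).
Proof.
move=> vs n lt_vs; have [lt_i|le_i] := ltnP i (size vs); last first.
  have [P HP] := computable0 lt_vs.
  by exists P => f f0; rewrite nth_default ?size_map //; apply: HP.
set v := nth 0 vs i; have lt_v : v < n by apply: (allP lt_vs); apply: mem_nth.
(* Emptying [v] into both [n] and [n.+1], then moving [n.+1] back, copies [v] without losing it. *)
exists (PSeq (PLoop v (PSeq (PInc n) (PInc n.+1))) (move_reg n.+1 v)) => f f0.
rewrite (nth_map 0) // -/v; clearbody v.
apply: (@runs_seq _ _ _ (upd (upd (upd f n (f v)) n.+1 (f v)) v 0)); last first.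
  apply: eq_runs (runs_move _ _ _ _) => //; last by lia.
  have E := f0 n.+1 (leqnSn n).
  by move=> j; regs.
suff H m g : g v = m -> runs (PLoop v (PSeq (PInc n) (PInc n.+1))) g
   (upd (upd (upd g n (g n + m)) n.+1 (g n.+1 + m)) v 0).
  by apply: eq_runs (H (f v) f erefl) => // j; rewrite (f0 n) // (f0 n.+1).
elim: m g => [|m IHm] g gm.
  by apply: eq_runs (runs_loop0 _ gm) => // j; regs.
apply: (runs_loopS gm (runs_seq (runs_inc _ _) (runs_inc _ _))).
apply: eq_runs (IHm _ _) => //.
  by move=> j; regs.
by regs.
Qed.

Lemma computable_let F G :
  computable F -> computable G -> computable (fun e => G (F e :: e)).
Proof.
move=> HF HG vs n lt_vs; have [P HP] := HF vs n lt_vs.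
have [|Q HQ] := HG (n :: vs) n.+1.
  by rewrite /= ltnSn (all_ltnW _ lt_vs).
exists (PSeq P (PSeq Q (PSeq (PClear n) (move_reg n.+1 n)))) => f f0.
apply: runs_seq (HP f f0) (runs_seq (HQ _ _) _).
  by move=> i lt_i; rewrite /upd; case: eqP => [|_]; [lia|apply: f0; lia].
apply: runs_seq (runs_clear _ _) _.
apply: eq_runs (runs_move _ _ _ _) => //; last by lia.
have E := f0 n.+1 (leqnSn n).
by move=> i; rewrite /= (map_upd _ _ lt_vs) //; regs.
Qed.

(** Renames arguments. The program for [F] works above register [n], which stays zero and stands for
    arguments beyond the end of the list. *)
Lemma computable_subst F ks d :
  computable F -> computable (fun e => F (map (nth 0 e) ks ++ drop d e)).
Proof.
move=> HF vs n lt_vs.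
have [|P HP] := HF (map (nth n vs) ks ++ drop d vs) n.+1.
  rewrite all_cat; apply/andP; split.
    apply/allP => v /mapP[k _ ->]; have [lt_k|le_k] := ltnP k (size vs).
      by rewrite ltnS ltnW // (allP lt_vs) ?mem_nth.
    by rewrite nth_default.
  apply/allP => v /mem_drop /(allP lt_vs); lia.
exists (PSeq P (move_reg n.+1 n)) => f f0; apply: runs_seq (HP _ _) _.
  by move=> i lt_i; apply: f0; lia.
rewrite map_cat map_drop -map_comp.
have -> : [seq (f \o nth n vs) i | i <- ks] = [seq nth 0 (map f vs) i | i <- ks].
  apply: eq_map => k /=; have [lt_k|le_k] := ltnP k (size vs).
    by rewrite (nth_map n).
  by rewrite !nth_default ?size_map // f0.
apply: eq_runs (runs_move _ _ _ _) => //; last by lia.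
have E := f0 n.+1 (leqnSn n); have E' := f0 n (leqnn n).
by move: (F _) => x i; regs.
Qed.

Lemma computable_iteri F G H :
  computable F -> computable G ->
  computable (fun e => H (nth 0 e 1) (nth 0 e 0) (drop 2 e)) ->
  computable (fun e => iteri (F e) (fun k a => H k a e) (G e)).
Proof.
move=> HF HG HH vs n lt_vs; have [P HP] := HF vs n lt_vs.
have [|Q HQ] := HG vs n.+1; first exact: all_ltnW lt_vs.
have [|B HB] := HH [:: n.+1, n.+2 & vs] n.+3.
  by rewrite /= (all_ltnW _ lt_vs); lia.
(* Register [n] counts the rounds left, [n.+1] holds the accumulator, [n.+2] the index of the round,
   [n.+3] the new accumulator. *)
pose body := PSeq B (PSeq (PClear n.+1) (PSeq (move_reg n.+3 n.+1) (PInc n.+2))).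
exists (PSeq P (PSeq Q (PSeq (PLoop n body)
  (PSeq (PClear n.+2) (move_reg n.+1 n))))) => f f0.
apply: runs_seq (HP f f0) (runs_seq (HQ _ _) _).
  by move=> i lt_i; rewrite /upd; case: eqP => [|_]; [lia|apply: f0; lia].
rewrite (map_upd _ _ lt_vs) //; set e := map f vs.
pose it k := iteri k (fun k a => H k a e) (G e).
pose st c k := upd (upd (upd f n c) n.+1 (it k)) n.+2 k.
have step c k : runs body (upd (st c.+1 k) n c) (st c k.+1).
  apply: runs_seq (HB _ _) _.
    by move=> i lt_i; rewrite /st /upd; do !case: eqP => [|_]; try lia; apply: f0; lia.
  apply: runs_seq (runs_clear _ _) (runs_seq (runs_move _ _ _ _) _); first by lia.
  apply: eq_runs (runs_inc _ _) => //.
  rewrite /= /st !(map_upd _ _ lt_vs) ?leqW // -/e drop0.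
  have := f0 n.+3; rewrite !leqW // => /(_ isT) E.
  by move=> i; regs.
have loop c k : runs (PLoop n body) (st c k) (st 0 (k + c)).
  elim: c k => [|c IHc] k.
    by rewrite addn0; apply: runs_loop0; rewrite /st; regs.
  have E : st c.+1 k n = c.+1 by rewrite /st; regs.
  by apply: (runs_loopS E (step _ _)); rewrite -addSnnS; apply: IHc.
have E1 := f0 n.+2 (leqW (leqnSn n)); have E2 := f0 n.+1 (leqnSn n).
apply: (@runs_seq _ _ _ (st 0 (F e))).
  apply: eq_runs (loop (F e) 0) => // i.
  by rewrite /st; regs.
apply: runs_seq (runs_clear _ _) _.
apply: eq_runs (runs_move _ _ _ _) => //; last by lia.
by rewrite /st => i; rewrite -/(it _); regs.
Qed.

Lemma computable_run F : computable F ->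
  exists p, forall x, exists fuel regs,
    mexec p fuel (minit x) = Some regs /\ regs 1 = F [:: x].
Proof.
(* The base register 1 fits the machine's convention: input in register 0, answer in register 1. *)
move=> /(_ [:: 0] 1 isT)[P HP]; exists (compile P 0 (size (compile P 0 0))) => x.
have [|g Eg R] := HP (minit x).2 _ [::] [::] (size (compile P 0 0)) _ (frefl _).
  by case.
case: R => k /(_ 0); rewrite /= cats0 => E; exists (k + 0), g; split.
  by rewrite E /= (size_compile _ _ _ 0 0) leqnn.
by rewrite Eg /upd /=.
Qed.

Lemma computable_drop d F : computable F -> computable (fun e => F (drop d e)).
Proof. exact: (@computable_subst F [::] d). Qed.

(** * Arithmetic, Boolean operations and bounded search *)

Lemma computable_const c : computable (fun=> c).
Proof. by elim: c => [|c /computableS]; [apply: computable0|]. Qed.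

Lemma computable_add F G :
  computable F -> computable G -> computable (fun e => F e + G e).
Proof.
move=> HF HG; have := computable_iteri HF HG (H := fun _ a _ => a.+1).
move/(_ (computableS (computable_var 0))); apply: eq_computable => e.
by elim: (F e) => //= n ->.
Qed.

Lemma computable_mul F G :
  computable F -> computable G -> computable (fun e => F e * G e).
Proof.
move=> HF HG.
have := computable_iteri HF computable0 (H := fun _ a e => G e + a).
move/(_ (computable_add (computable_drop 2 HG) (computable_var 0))).
by apply: eq_computable => e; elim: (F e) => //= n ->; rewrite mulSn.
Qed.

Lemma computable_subn F G :
  computable F -> computable G -> computable (fun e => F e - G e).
Proof.
move=> HF HG.
have Hpred H : computable H -> computable (fun e => (H e).-1).
  (* The predecessor is the index of the last round of a loop. *)
  move=> HH; have := computable_iteri HH computable0 (H := fun k _ _ => k).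
  by move/(_ (computable_var 1)); apply: eq_computable => e; case: (H e).
have := computable_iteri HG HF (H := fun _ a _ => a.-1).
move/(_ (Hpred _ (computable_var 0))); apply: eq_computable => e.
by elim: (G e) => [|n /= ->]; rewrite ?subn0 ?subnS.
Qed.

Lemma computable_if (p : seq nat -> bool) F G :
  computable p -> computable F -> computable G ->
  computable (fun e => if p e then F e else G e).
Proof.
move=> Hp HF HG; have := computable_iteri Hp HG (H := fun _ _ e => F e).
by move/(_ (computable_drop 2 HF)); apply: eq_computable => e; case: (p e).
Qed.

Lemma computable_eq F G :
  computable F -> computable G -> computable (fun e => F e == G e).
Proof.
move=> HF HG.
(* The truncated differences in both orders add up to zero exactly for equal numbers. *)
have H := computable_add (computable_subn HF HG) (computable_subn HG HF).
apply: eq_computable (computable_subn (computable_const 1) H) => e /=.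
by case: eqP; lia.
Qed.

Lemma computable_neg (p : seq nat -> bool) :
  computable p -> computable (fun e => ~~ p e).
Proof.
move=> Hp; apply: eq_computable (computable_subn (computable_const 1) Hp).
by move=> e; case: (p e).
Qed.

Lemma computable_and (p q : seq nat -> bool) :
  computable p -> computable q -> computable (fun e => p e && q e).
Proof.
by move=> Hp Hq; apply: eq_computable (computable_mul Hp Hq) => e; rewrite mulnb.
Qed.

Lemma computable_or (p q : seq nat -> bool) :
  computable p -> computable q -> computable (fun e => p e || q e).
Proof.
move=> Hp Hq; apply: eq_computable (computable_neg (computable_and
  (computable_neg Hp) (computable_neg Hq))) => e.
by rewrite negb_and !negbK.
Qed.

Lemma computable_exists F (p : nat -> seq nat -> bool) :
  computable F -> computable (fun e => p (nth 0 e 1) (drop 2 e)) ->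
  computable (fun e => has (p^~ e) (iota 0 (F e))).
Proof.
move=> HF Hp.
have := computable_iteri HF computable0 (H := fun k a e => (a == 1) || p k e).
move/(_ (computable_or (computable_eq (computable_var 0) (computable_const 1)) Hp)).
apply: eq_computable => e; elim: (F e) => [|n IH] //.
by rewrite -[n.+1]addn1 iotaD has_cat /= addn1 /= IH orbF; case: has.
Qed.

(** * Codes of lists *)

Definition chd n := head 0 (CodeSeq.decode n).
Definition ctl n := CodeSeq.code (behead (CodeSeq.decode n)).
(** The arithmetic step by which [CodeSeq.code] puts a head in front of a coded list; every positive
    number is uniquely of this form. *)
Definition ccons n m := 2 ^ n * (m.*2).+1.

Lemma cconsE n m : ccons n m = CodeSeq.code (n :: CodeSeq.decode m).
Proof. by rewrite /= CodeSeq.decodeK. Qed.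

Lemma chd_code n s : chd (CodeSeq.code (n :: s)) = n.
Proof. by rewrite /chd CodeSeq.codeK. Qed.

Lemma ctl_code n s : ctl (CodeSeq.code (n :: s)) = CodeSeq.code s.
Proof. by rewrite /ctl CodeSeq.codeK. Qed.

Lemma chd_ccons n m : chd (ccons n m) = n.
Proof. by rewrite cconsE chd_code. Qed.

Lemma ctl_ccons n m : ctl (ccons n m) = m.
Proof. by rewrite cconsE ctl_code CodeSeq.decodeK. Qed.

Lemma ltn_ccons n m : (n < ccons n m) && (m < ccons n m).
Proof.
have := ltn_expl n (isT : 1 < 2); rewrite /ccons -muln2; set x := 2 ^ n.
by nia.
Qed.

Lemma nat_ccons y : y = 0 \/ y = ccons (chd y) (ctl y).
Proof.
rewrite -[y]CodeSeq.decodeK; case: (CodeSeq.decode y) => [|n s]; first by left.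
by right; rewrite cconsE chd_code ctl_code CodeSeq.codeK.
Qed.

Lemma computable_ccons F G :
  computable F -> computable G -> computable (fun e => ccons (F e) (G e)).
Proof.
move=> HF HG; apply: computable_mul.
  have := computable_iteri HF (computable_const 1) (H := fun _ a _ => a + a).
  move/(_ (computable_add (computable_var 0) (computable_var 0))).
  by apply: eq_computable => e; elim: (F e) => //= n ->; rewrite addnn -mul2n expnS.
by apply: eq_computable (computableS (computable_add HG HG)) => e; rewrite addnn.
Qed.

Lemma iteri_find (p : pred nat) y n :
  n < y -> (forall k, p k = (k == n)) ->
  iteri y (fun k a => if p k then k else a) 0 = n.
Proof.
move=> lt_ny Hp; elim: y lt_ny => //= y IH; rewrite ltnS leq_eqVlt Hp.
by case/predU1P => [->|lt_ny]; [rewrite eqxx|rewrite gtn_eqF // IH].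
Qed.

(* The head and the tail of the list coded by [y <> 0] are the unique
   solution of [y = ccons k m], and both are below [y]: they can be found
   by bounded search. *)
Lemma computable_search F (q : nat -> nat -> seq nat -> bool) (h : nat -> nat) :
  computable F ->
  computable (fun e => q (nth 0 e 1) (nth 0 e 3) (drop 4 e)) ->
  h 0 = 0 ->
  (forall e, F e != 0 ->
     h (F e) < F e /\ forall k, has (q^~ k ^~ e) (iota 0 (F e)) = (k == h (F e))) ->
  computable (fun e => h (F e)).
Proof.
move=> HF Hq h0 Hh.
have := computable_iteri HF computable0
  (H := fun k a e => if has (fun m => q m k e) (iota 0 (F e)) then k else a).
have H1 : computable (fun e => has (fun m => q m (nth 0 e 1) (drop 2 e))
   (iota 0 (F (drop 2 e)))).
  apply: (@computable_exists (fun e => F (drop 2 e))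
    (fun m e => q m (nth 0 e 1) (drop 2 e))).
    exact: computable_drop.
  by apply: eq_computable Hq => e; rewrite nth_drop drop_drop.
move/(_ (computable_if H1 (computable_var 1) (computable_var 0))).
apply: eq_computable => e; have [F0|nz] := eqVneq (F e) 0.
  by rewrite F0 h0.
by have [lt_h Hk] := Hh e nz; apply: iteri_find.
Qed.

Lemma computable_chd F : computable F -> computable (fun e => chd (F e)).
Proof.
move=> HF; apply: (@computable_search _ (fun m k e => F e == ccons k m)) => //.
  apply: computable_eq (computable_drop 4 HF) _.
  exact: computable_ccons (computable_var _) (computable_var _).
move=> e /eqP nz; have [//|E] := nat_ccons (F e).
have /andP[lt1 lt2] := ltn_ccons (chd (F e)) (ctl (F e)).
split; first by rewrite {2}E.
move=> k; apply/hasP/eqP => [[m _ /eqP ->]|->]; first by rewrite chd_ccons.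
by exists (ctl (F e)); [rewrite mem_iota /= {2}E|rewrite -E].
Qed.

Lemma computable_ctl F : computable F -> computable (fun e => ctl (F e)).
Proof.
move=> HF; apply: (@computable_search _ (fun k m e => F e == ccons k m)) => //.
  apply: computable_eq (computable_drop 4 HF) _.
  exact: computable_ccons (computable_var _) (computable_var _).
move=> e /eqP nz; have [//|E] := nat_ccons (F e).
have /andP[lt1 lt2] := ltn_ccons (chd (F e)) (ctl (F e)).
split; first by rewrite {2}E.
move=> k; apply/hasP/eqP => [[m _ /eqP ->]|->]; first by rewrite ctl_ccons.
by exists (chd (F e)); [rewrite mem_iota /= {2}E|rewrite -E].
Qed.

(** Each new head makes the code strictly larger. Hence the code of a list can bound the number of
    rounds of a loop over it. *)
Lemma size_leq_code s : size s <= CodeSeq.code s.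
Proof.
elim: s => //= n s IH; rewrite -(CodeSeq.codeK s) in IH *.
have /andP[_] := ltn_ccons n (CodeSeq.code s); rewrite /ccons CodeSeq.codeK in IH *.
exact: leq_ltn_trans.
Qed.

(** Round [k] handles the entry at index [k]; once the list is used up, the tail has code 0 and the
    remaining rounds do nothing. *)
Lemma foldl_iteri (h : nat -> nat -> nat) a y :
  iteri y (fun k a => if iter k ctl y == 0 then a else h a (chd (iter k ctl y))) a
  = foldl h a (CodeSeq.decode y).
Proof.
set s := CodeSeq.decode y.
have it k : iter k ctl y = CodeSeq.code (drop k s).
  elim: k => [|k IH]; first by rewrite drop0 CodeSeq.decodeK.
  by rewrite iterS IH /ctl CodeSeq.codeK -drop1 drop_drop.
have le_s : size s <= y by rewrite -[y]CodeSeq.decodeK size_leq_code.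
(* Truncating the list to the number of rounds gives the invariant for the induction. *)
rewrite -[in RHS](take_oversize le_s).
elim: {1 4}y => [|n IH]; first by rewrite take0.
rewrite iteriS {}IH it; have [lt_n|le_n] := ltnP n (size s).
  rewrite (drop_nth 0) // chd_code (take_nth 0) // foldl_rcons.
  by case: eqP => // /(can_inj CodeSeq.codeK (x2 := [::])).
by rewrite drop_oversize // !take_oversize // leqW.
Qed.

Lemma computable_foldl F G H :
  computable F -> computable G ->
  computable (fun e => H (nth 0 e 0) (nth 0 e 1) (drop 2 e)) ->
  computable (fun e => foldl (fun a n => H a n e) (G e) (CodeSeq.decode (F e))).
Proof.
move=> HF HG HH.
have := computable_iteri HF HG (H := fun k a e =>
  if iter k ctl (F e) == 0 then a else H a (chd (iter k ctl (F e))) e).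
have Hit : computable (fun e => iter (nth 0 e 1) ctl (F (drop 2 e))).
  have := computable_iteri (computable_var 1) (computable_drop 2 HF)
    (H := fun _ a _ => ctl a).
  move/(_ (computable_ctl (computable_var 0))); apply: eq_computable => e.
  by elim: (nth _ _ _) => //= n ->.
(* The environment starts with head, accumulator and index; the substitution swaps the first two and
   drops the index. *)
have H1 := computable_let (computable_chd Hit)
  (computable_subst [:: 1; 0] 3 HH).
have H2 := computable_eq Hit computable0.
move/(_ (eq_computable _ (computable_if H2 (computable_var 0) H1))) => K.
apply: eq_computable (K _) => [e|e].
  by rewrite -foldl_iteri.
by rewrite /= !drop0.
Qed.

Lemma computable_has F (p : nat -> seq nat -> bool) :
  computable F -> computable (fun e => p (nth 0 e 1) (drop 2 e)) ->
  computable (fun e => has (p^~ e) (CodeSeq.decode (F e))).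
Proof.
move=> HF Hp.
have := computable_foldl HF computable0 (H := fun a k e => (a == 1) || p k e).
move/(_ (computable_or (computable_eq (computable_var 0) (computable_const 1)) Hp)).
apply: eq_computable => e; set s := CodeSeq.decode _.
suff H (b : bool) t :
    foldl (fun a k => nat_of_bool ((a == 1) || p k e)) b t
    = (b || has (p^~ e) t) by exact: (H false s).
by elim: t b => [|k t IH] b /=; rewrite ?orbF // IH; case: b; case: (p k e).
Qed.

(* The accumulator of [foldl] reverses the filtered list. *)
Lemma computable_rev_filter F (p : nat -> seq nat -> bool) :
  computable F -> computable (fun e => p (nth 0 e 1) (drop 2 e)) ->
  computable (fun e =>
    CodeSeq.code (rev (filter (p^~ e) (CodeSeq.decode (F e))))).
Proof.
move=> HF Hp.
have := computable_foldl HF computable0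
  (H := fun a k e => if p k e then ccons k a else a).
move/(_ (computable_if Hp (computable_ccons (computable_var 1)
  (computable_var 0)) (computable_var 0))).
apply: eq_computable => e; set s := CodeSeq.decode _.
rewrite -[X in foldl _ X _]/(CodeSeq.code [::]) /rev.
elim: s [::] => //= k s IH t; case: (p k e); last exact: IH.
by rewrite cconsE CodeSeq.codeK IH.
Qed.

Lemma computable_mem F (s : seq nat) :
  computable F -> computable (fun e => F e \in s).
Proof.
move=> HF; elim: s => [|x s IH]; first exact: computable0.
by apply: (computable_or (computable_eq HF (computable_const x)) IH).
Qed.

Import GRing.Theory Num.Theory.

(** * Pruning the edges *)
(** Agrees by computation with [pickle] on triples, so that [code_tgraph] can be read by the list
    operations. *)
Definition ecode (e : nat * nat * nat) : nat :=
  CodeSeq.code [:: CodeSeq.code [:: e.1.1; e.1.2]; e.2].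
Definition csrc c := chd (chd c).
Definition ctgt c := chd (ctl (chd c)).
Definition cdir c := chd (ctl c).

Lemma csrc_ecode e : csrc (ecode e) = e.1.1.
Proof. by rewrite /csrc !chd_code. Qed.

Lemma ctgt_ecode e : ctgt (ecode e) = e.1.2.
Proof. by rewrite /ctgt chd_code ctl_code chd_code. Qed.

Lemma cdir_ecode e : cdir (ecode e) = e.2.
Proof. by rewrite /cdir ctl_code chd_code. Qed.

Lemma code_tgraphE G :
  code_tgraph G = CodeSeq.code [:: ntiles G; CodeSeq.code (map ecode (tedges G))].
Proof. by []. Qed.

(* For directions below 4, the last two conditions say that [dinv] does not
   exchange the directions of [c] and [c']. *)
Definition csucc c c' :=
  [&& ctgt c == csrc c', cdir c != cdir c' + 2 & cdir c' != cdir c + 2].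

Definition extendable s c := has (csucc c) s && has (csucc^~ c) s.

(** The reversal is that of the computable filter; it leaves membership unchanged. *)
Definition prune s := rev (filter (extendable s) s).

(** [y] is at once the coded edge list and the number of rounds, which suffices since a list is no
    longer than its code. *)
Definition live_edges (ds : seq nat) y :=
  iter y prune (rev [seq c <- CodeSeq.decode y | cdir c \in ds]).

Lemma computable_csucc F G :
  computable F -> computable G -> computable (fun e => csucc (F e) (G e)).
Proof.
move=> HF HG.
have Hdir H : computable H -> computable (fun e => cdir (H e)).
  by move=> HH; apply/computable_chd/computable_ctl.
have Hdir2 H : computable H -> computable (fun e => cdir (H e) + 2).
  by move=> HH; apply: computable_add (Hdir _ HH) (computable_const 2).
apply: computable_and.
  apply: computable_eq; last exact/computable_chd/computable_chd.
  exact/computable_chd/computable_ctl/computable_chd.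
apply: computable_and; apply: computable_neg; apply: computable_eq; auto.
Qed.

Lemma computable_prune F : computable F ->
  computable (fun e => CodeSeq.code (prune (CodeSeq.decode (F e)))).
Proof.
move=> HF.
apply: (@computable_rev_filter F (fun c e => extendable (CodeSeq.decode (F e)) c)).
  exact: HF.
have HF2 := computable_drop 2 HF.
have Hc := computable_drop 2 (computable_var 1).
apply: computable_and.
  apply: (computable_has (p := fun j e => csucc (nth 0 e 1) j) HF2).
  exact: computable_csucc Hc (computable_var 1).
apply: (computable_has (p := fun j e => csucc j (nth 0 e 1)) HF2).
exact: computable_csucc (computable_var 1) Hc.
Qed.

Lemma computable_live_edges ds F : computable F ->
  computable (fun e => CodeSeq.code (live_edges ds (F e))).
Proof.
move=> HF.
have Hp : computable (fun e => cdir (nth 0 e 1) \in ds).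
  exact/computable_mem/computable_chd/computable_ctl/computable_var.
have H0 := computable_rev_filter (p := fun c _ => cdir c \in ds) HF Hp.
have := computable_iteri HF H0
  (H := fun _ a _ => CodeSeq.code (prune (CodeSeq.decode a))).
move/(_ (computable_prune (computable_var 0))); apply: eq_computable => e.
rewrite /live_edges; elim: {1 3}(F e) => //= n ->.
by rewrite CodeSeq.codeK.
Qed.

(** * Stable edge sets and bi-infinite walks *)

Definition stable s := all (extendable s) s.

Lemma mem_prune s c : (c \in prune s) = (c \in s) && extendable s c.
Proof. by rewrite mem_rev mem_filter andbC. Qed.

Lemma stable_prune s : stable s -> stable (prune s).
Proof.
move=> st; have -> : prune s = rev s by rewrite /prune (all_filterP st).
by rewrite /stable all_rev; apply: sub_all st => c; rewrite /extendable !has_rev.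
Qed.

(** A round that deletes nothing shows stability, which later rounds preserve; any other round
    shortens the list. *)
Lemma stable_iter_prune n s : size s <= n -> stable (iter n prune s).
Proof.
elim: n s => [|n IH] s; first by rewrite leqn0 size_eq0 => /eqP ->.
rewrite iterSr => le_s.
have [lt_p|ge_p] := ltnP (size (prune s)) (size s); first by apply: IH; lia.
have /stable_prune : stable s.
  move: ge_p; rewrite /stable all_count /prune size_rev size_filter.
  by rewrite eqn_leq count_size.
by elim: (n) (prune s) => // m IHm t /stable_prune; rewrite iterSr; apply: IHm.
Qed.

Definition walk (s : seq nat) (eps : int -> nat) :=
  forall i : int, eps i \in s /\ csucc (eps i) (eps (i + 1)%R).

(** The neighbours along the walk witness that each of its edges is extendable. *)
Lemma walk_prune s eps : walk s eps -> walk (prune s) eps.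
Proof.
move=> w i; have [si sci] := w i; split=> //; rewrite mem_prune si /=.
have [s1 _] := w (i + 1)%R; have [s0 sc0] := w (i - 1)%R.
rewrite subrK in sc0; apply/andP; split; apply/hasP.
  by exists (eps (i + 1)%R).
by exists (eps (i - 1)%R).
Qed.

Lemma walk_subset s s' eps : {subset s <= s'} -> walk s eps -> walk s' eps.
Proof. by move=> ss' w i; have [/ss' ? ?] := w i. Qed.

(* The survivors of the pruning have successors and predecessors among
   themselves, so a walk is grown from any of them in both directions. *)
Lemma stable_walk s c : stable s -> c \in s -> exists eps, walk s eps.
Proof.
move=> /allP st sc.
pose f c := nth 0 s (find (csucc c) s).
pose g c := nth 0 s (find (csucc^~ c) s).
have fP x : x \in s -> f x \in s /\ csucc x (f x).
  move=> /st/andP[hf _]; split; last exact: nth_find.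
  by rewrite mem_nth // -has_find.
have gP x : x \in s -> g x \in s /\ csucc (g x) x.
  move=> /st/andP[_ hg]; split; last exact: (nth_find 0 hg).
  by rewrite mem_nth // -has_find.
have fs n : iter n f c \in s by elim: n => //= n /fP[].
have gs n : iter n g c \in s by elim: n => //= n /gP[].
exists (fun i => match i with Posz n => iter n f c | Negz n => iter n.+1 g c end).
case=> [n|[|n]].
- split=> //; rewrite -PoszD addn1; exact: (fP _ (fs n)).2.
- split; first exact: gs 1.
  by rewrite NegzE addNr; apply: (gP _ sc).2.
- split; first exact: gs n.+2.
  have -> : (Negz n.+1 + 1 = Negz n)%R by lia.
  exact: (gP _ (gs n.+1)).2.
Qed.

(** After [y] rounds the survivors are stable, so any one of them starts a walk; conversely no edge
    of a walk is ever deleted. *)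
Lemma live_edgesP ds y :
  live_edges ds y != [::] <->
  exists eps, walk [seq c <- CodeSeq.decode y | cdir c \in ds] eps.
Proof.
rewrite /live_edges; set s := filter _ _.
have sub_iter n t : {subset iter n prune t <= t}.
  by elim: n t => [|n IH] t c //; rewrite iterS mem_prune => /andP[/IH].
split=> [nz|[eps w]].
  have : stable (iter y prune (rev s)).
    apply: stable_iter_prune; rewrite size_rev size_filter.
    by rewrite (leq_trans (count_size _ _)) // -{2}[y]CodeSeq.decodeK size_leq_code.
  case E: (iter y prune (rev s)) nz => [//|c t] _ st.
  have [|eps w] := stable_walk (c := c) st; first by rewrite mem_head.
  exists eps; apply: walk_subset w => x; rewrite -E => /sub_iter.
  by rewrite mem_rev.
have : walk (iter y prune (rev s)) eps.
  elim: (y) => [|n IH] /=; last exact: walk_prune.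
  by apply: walk_subset w => x; rewrite mem_rev.
by move=> /(_ 0%R)[]; case: (iter _ _ _).
Qed.

(** * Snakes and walks *)

Local Open Scope ring_scope.

(** Recovers positions from steps. [Negz n] is [-(n+1)], hence the extra term in the sum on the
    negative side. *)
Lemma int_antiderivative (v : int -> int) :
  exists w : int -> int, forall i, w (i + 1) = w i + v i.
Proof.
exists (fun i => match i with
  | Posz n => \sum_(k < n) v (Posz k)
  | Negz n => - \sum_(k < n.+1) v (Negz k) end).
case=> [n|[|n]].
- by rewrite -PoszD addn1 big_ord_recr.
- by rewrite (_ : Negz 0 + 1 = Posz 0) // big_ord0 big_ord1 addNr.
- have -> : Negz n.+1 + 1 = Negz n by lia.
  by rewrite [in RHS]big_ord_recr /= opprD subrK.
Qed.

(** * Injectivity of nonbacktracking paths that miss a direction *)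

Definition backtrack (s s' : 'I_4) : bool :=
  (val s == s' + 2)%N || (val s' == s + 2)%N.

Lemma vadd_backtrack u s s' :
  backtrack s s' -> vadd (vadd u (dvec s)) (dvec s') = u.
Proof.
case: u => a b; case: s => [[|[|[|[|//]]]] ?]; case: s' => [[|[|[|[|//]]]] ?] //= _;
  by rewrite /vadd /dvec /=; congr pair; lia.
Qed.

(** The displacement against [d], as minus the inner product with [dvec d]. *)
Definition height (d : 'I_4) (u : int * int) : int :=
  - (u.1 * (dvec d).1 + u.2 * (dvec d).2).

Lemma height_vadd d u v : height d (vadd u v) = height d u + height d v.
Proof. by rewrite /height /vadd /=; lia. Qed.

Lemma height_ge0 d s : s != d -> 0 <= height d (dvec s).
Proof.
by case: d => [[|[|[|[|//]]]] ?]; case: s => [[|[|[|[|//]]]] ?].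
Qed.

(** A step of height 0 is perpendicular to [d]. Of the directions other than [d], one rises, one is
    [s], and one is opposite to [s] and thus excluded. *)
Lemma height_turn d s s' : height d (dvec s) = 0 -> s' != d -> ~~ backtrack s s' ->
  0 < height d (dvec s') \/ s' = s.
Proof.
case: d => [[|[|[|[|//]]]] ?]; case: s => [[|[|[|[|//]]]] ?] //;
  case: s' => [[|[|[|[|//]]]] ?] //= _ _ _; try (by left);
  by right; apply: val_inj.
Qed.

(** Induction on [n]: height once gained is never lost, and as long as none is gained each step
    repeats the one before. *)
Lemma nonbacktracking_path d (omega : int -> int * int) (sg : int -> 'I_4) :
  (forall i, omega (i + 1) = vadd (omega i) (dvec (sg i))) ->
  (forall i, sg i != d) -> (forall i, ~~ backtrack (sg i) (sg (i + 1))) ->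
  forall i (n : nat),
    height d (omega i) < height d (omega (i + n%:Z + 1)) \/
    height d (dvec (sg (i + n%:Z))) = 0 /\
    omega (i + n%:Z + 1) = vadd (omega i)
      ((n%:Z + 1) * (dvec (sg (i + n%:Z))).1, (n%:Z + 1) * (dvec (sg (i + n%:Z))).2).
Proof.
move=> step nd nb i; elim=> [|n IH].
  rewrite addr0 step !add0r !mul1r -surjective_pairing height_vadd.
  have := height_ge0 (nd i); case: (eqVneq (height d (dvec (sg i))) 0); last by lia.
  by right.
have -> : i + n.+1%:Z = i + n%:Z + 1 by lia.
set j := i + n%:Z in IH *; rewrite (step (j + 1)) height_vadd.
have ge0 := height_ge0 (nd (j + 1)).
case: IH => [lt_h|[h0 E]]; first by left; lia.
(* The displacement so far is a multiple of a step of height 0. *)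
have hj : height d (omega (j + 1)) = height d (omega i).
  rewrite E height_vadd; move: h0; rewrite /height /=; move: (dvec _) => [a b] /=; nia.
have [gt0|Es] := height_turn h0 (nd (j + 1)) (nb j); first by left; lia.
right; rewrite Es; split=> //; rewrite E /vadd /=; congr pair; lia.
Qed.

(** A later position is either strictly higher or a nonzero multiple of a unit step away. *)
Lemma nonbacktracking_injective d (omega : int -> int * int) (sg : int -> 'I_4) :
  (forall i, omega (i + 1) = vadd (omega i) (dvec (sg i))) ->
  (forall i, sg i != d) -> (forall i, ~~ backtrack (sg i) (sg (i + 1))) ->
  injective omega.
Proof.
move=> step nd nb.
have H i (n : nat) : omega i <> omega (i + n%:Z + 1).
  move=> E; case: (nonbacktracking_path step nd nb i n) => [|[_]]; rewrite -E.
    by lia.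
  move/eqP; case: (omega i) => a b; rewrite /vadd /= => /eqP[].
  by case: (sg _) => [[|[|[|[|//]]]] ?]; rewrite /dvec /=; lia.
move=> i j E; case: (ltrgtP i j) => // ij.
  (* The [- 1] compensates the [+ 1] built into [H]. *)
  by case: (H i (absz (j - i - 1)%R)); rewrite E; congr omega; lia.
by case: (H j (absz (i - j - 1)%R)); rewrite -E; congr omega; lia.
Qed.

(** [xchoose] picks a direction at each index without a choice axiom; for this the conditions on
    snakes and walks are restated as Boolean ones below. *)
Lemma all_choose I (T : choiceType) (p : I -> pred T) :
  (forall i, exists x, p i x) -> exists f, forall i, p i (f i).
Proof. by move=> ex; exists (fun i => xchoose (ex i)) => i; apply: xchooseP. Qed.

(** A snake yields the walk of its edges. A walk gives back the tiles as sources of its edges and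
    the positions by summing directions; avoiding [d] makes the positions distinct. *)
Lemma has_dsnakeP (D : {set 'I_4}) G d : d \notin D ->
  has_dsnake D G <->
  exists eps, walk [seq c <- map ecode (tedges G) | cdir c \in map val (enum D)] eps.
Proof.
move=> dD; split=> [[omega [zeta [inj sn]]]|[eps w]].
  have ex i : exists s : 'I_4, [&& s \in D, omega (i + 1) == vadd (omega i) (dvec s)
      & (zeta i, zeta (i + 1), val s) \in tedges G].
    by have [s [sD /eqP Es es]] := sn i; exists s; rewrite sD Es.
  have [sg sgP] := all_choose ex.
  exists (fun i => ecode (zeta i, zeta (i + 1), val (sg i))) => i; split.
    have /and3P[sD _ es] := sgP i.
    rewrite mem_filter cdir_ecode [X in X && _]map_f ?mem_enum // andTb.
    exact: map_f.
  rewrite /csucc ctgt_ecode csrc_ecode !cdir_ecode /= eqxx -negb_or.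
  (* Opposite consecutive steps would bring the snake back to its position two steps earlier. *)
  apply/negP => /vadd_backtrack bt.
  have /and3P[_ /eqP E0 _] := sgP i; have /and3P[_ /eqP E1 _] := sgP (i + 1).
  have : omega (i + 1 + 1) = omega i by rewrite E1 E0 bt.
  by move/inj; lia.
have edge i : exists s : 'I_4, [&& s \in D, cdir (eps i) == val s &
    (csrc (eps i), ctgt (eps i), val s) \in tedges G].
  have [] := w i; rewrite mem_filter => /andP[/mapP[s sD Es] /mapP[e eE Ee]] _.
  rewrite mem_enum in sD; exists s; rewrite sD Es eqxx -Es Ee.
  rewrite csrc_ecode ctgt_ecode cdir_ecode.
  by case: (e) eE => [[]].
have [sg sgP] := all_choose edge.
have [w1 E1] := int_antiderivative (fun i => (dvec (sg i)).1).
have [w2 E2] := int_antiderivative (fun i => (dvec (sg i)).2).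
have step i : (w1 (i + 1), w2 (i + 1)) = vadd (w1 i, w2 i) (dvec (sg i)).
  by rewrite E1 E2.
exists (fun i => (w1 i, w2 i)), (fun i => csrc (eps i)); split.
  apply: (nonbacktracking_injective (d := d) (sg := sg)) => // i.
    by apply: contraNneq dD => <-; have /and3P[] := sgP i.
  have [_ /and3P[_ n1 n2]] := w i.
  have /and3P[_ /eqP Es _] := sgP i; have /and3P[_ /eqP Es' _] := sgP (i + 1).
  by rewrite /backtrack negb_or; move: n1 n2; rewrite Es Es' => -> ->.
move=> i; have /and3P[sD _ es] := sgP i; exists (sg i); split=> //.
by have [_ /and3P[/eqP <- _ _]] := w i.
Qed.

Local Close Scope ring_scope.

Theorem theorem2 (D : {set 'I_4}) :
  #|D| = 2 \/ #|D| = 3 -> decidable_tg (has_dsnake D).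
Proof.
move=> cardD.
have [d dD] : exists d, d \notin D.
  apply/existsP; rewrite -negb_forall; apply/negP => /forallP allD.
  have : #|D| = #|'I_4| by apply: eq_card => x; rewrite allD.
  by rewrite card_ord; case: cardD => ->.
pose ds := map val (enum D).
(* The edge list is the second entry of the coded graph; the machine answers whether the code of its
   live part is nonzero. *)
have := computable_neg (computable_eq (computable_live_edges ds
  (computable_chd (computable_ctl (computable_var 0)))) computable0).
move/computable_run => [p Hp]; exists p => G _.
have [fuel [regs [Hrun Eregs]]] := Hp (code_tgraph G).
exists fuel, regs; split=> //; move: Eregs.
rewrite [nth 0 _ _]code_tgraphE ctl_code chd_code => ->; set y := CodeSeq.code (map _ _).
have iff : live_edges ds y != [::] <-> has_dsnake D G.
  have := live_edgesP ds y; rewrite {2}/y CodeSeq.codeK => live.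
  exact: iff_trans live (iff_sym (has_dsnakeP G dD)).
(* Only the empty list has code 0. *)
have -> : (CodeSeq.code (live_edges ds y) == 0) = (live_edges ds y == [::]).
  exact: (can_eq CodeSeq.codeK _ [::]).
case: eqP iff => _ iff; [right|left]; split=> //; last exact/iff.
by move/iff.
Qed.
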